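(* For every $a,b\in\mathbb{R}$ with $0<a<b$ there exist two absolutely continuous probability measures $\mu_f,\mu_g$ supported on $[a,b]$ with $C^\infty$ densities $f,g$ and a strictly increasing sequence of positive integers $(\ell_n)_{n\in\mathbb{N}}$ such that $s_{\ell_n}(\mu_f)<s_{\ell_n}(\mu_g)$ for odd $n\in\mathbb{N}$ and $s_{\ell_n}(\mu_f)>s_{\ell_n}(\mu_g)$ for even $n\in\mathbb{N}$.
   Context: $\mathbb{N}=\{0,1,2,\dots\}$. The moments of $\mu$ are $s_k(\mu)=\int_0^\infty t^k\,d\mu(t)$, $k\in\mathbb{N}$. Densities are with respect to Lebesgue measure and are $C^\infty$ functions on $\mathbb{R}$ with support contained in $[a,b]$. *)

(* Defs.v *)
From HB Require Import structures.
From mathcomp Require Import all_boot all_order all_algebra.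
From mathcomp Require Import all_classical all_reals all_analysis.

Set Implicit Arguments.
Unset Strict Implicit.
Unset Printing Implicit Defensive.

Import Order.TTheory GRing.Theory Num.Theory.
Import numFieldNormedType.Exports.

Local Open Scope classical_set_scope.
Local Open Scope ring_scope.

(* [derivable _ x 1] at every point and every order gives existence, hence also
   continuity, of all the iterated derivatives. *)
Definition smooth (R : realType) (f : R -> R) : Prop :=
  forall (n : nat) (x : R), derivable (derive1n n f) x 1.

Definition fun_supp (R : realType) (f : R -> R) : set R :=
  closure [set x : R | f x != 0].

Definition is_density (R : realType)
    (mu : probability (measurableTypeR R) R) (f : R -> R) : Prop :=
  [/\ measurable_fun [set: measurableTypeR R] (f : measurableTypeR R -> R),
      forall x : R, 0 <= f x
    & forall A : set (measurableTypeR R), measurable A ->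
        mu A = (\int[lebesgue_measure]_(x in A) (f x)%:E)%E].

(* Only meaningful for Borel [K]; [mu] is junk on non-measurable sets. *)
Definition supported_on (R : realType)
    (mu : probability (measurableTypeR R) R) (K : set R) : Prop :=
  mu (~` K) = 0%E.

(* Extended-real valued, so that no junk value arises for a measure whose
   [k]-th moment is infinite. *)
Definition moment (R : realType)
    (mu : probability (measurableTypeR R) R) (k : nat) : \bar R :=
  (\int[mu]_(t in `[0%R, +oo[) (t ^+ k)%:E)%E.

(* Main.v *)
Require Import Defs.
From HB Require Import structures.
From mathcomp Require Import all_boot all_order all_algebra.
From mathcomp Require Import ring lra.
From mathcomp Require Import all_classical all_reals all_analysis.
From mathcomp Require Import measurable_realfun.

Set Implicit Arguments.
Unset Strict Implicit.
Unset Printing Implicit Defensive.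

Import Order.TTheory GRing.Theory Num.Theory.
Import numFieldNormedType.Exports.

Local Open Scope classical_set_scope.
Local Open Scope ring_scope.

(** The substitution [y = (t - a) / (b - t) = expR u] carries ]a, b[ onto the
    half-line, and turns the question into one about the log-normal law, whose
    moment problem is indeterminate: all moments of order [n] in [y] of the
    signed density [expR (- u ^+ 2) * sin (2 pi u)], taken against [du],
    vanish. Indeed the reflection [u -> n - u] preserves [expR (- u ^+ 2 + n *
    u)] and changes the sign of the sine. The measures are
      [mu_g = expR (- u ^+ 2) du / Z] and
      [mu_f = (1 + sin (2 pi u)) expR (- u ^+ 2) du / Z],
    so that the moments of [mu_f] and [mu_g] differ by a positive multiple of
    those of the signed density [ripple].

    Since [t / (b - t)] is an affine function of [y], the integral of [ripple
    t * (t / (b - t)) ^+ K] is zero for every [K] ([integral_wave_affine]). On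
    the other hand, for [0 < K], [(t / (b - t)) ^+ K] is a power series in [t]
    that starts at [t ^+ K] and has only positive coefficients from there on.
    If the moments of order at least [K] of [ripple] were all nonnegative,
    summing that series would give zero as a positive combination of all of
    them, so they would all vanish ([moments_eq0]). This is impossible for a
    continuous function which is positive somewhere on ]a, b[
    ([moments_not_all0]). Hence negative moments occur beyond any order; the
    same argument for [- ripple] gives positive ones ([ripple_moment_lt0]),
    and the orders [l n] are picked in turn ([alternating_sequence]).

    Both densities are [C^oo] because the functions [expR (- u ^+ 2) * p u],
    with [p] a polynomial expression in [u], [expR u], [expR (- u)], [sin (2
    pi u)] and [cos (2 pi u)], are stable under differentiation with respect
    to [t] and vanish at [a] and [b] faster than any power ([smooth_bump]). *)

(** * Exponential-trigonometric expressions *)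

(** A class closed under products and derivation, and of at most exponential
    growth: Gaussian multiples of its members are bounded and stable under
    derivation. *)
Inductive exptrig (R : realType) (w : R) : (R -> R) -> Prop :=
| exptrig_cst c : exptrig w (fun=> c)
| exptrig_id : exptrig w (fun x => x)
| exptrig_exp : exptrig w (fun x => expR x)
| exptrig_expN : exptrig w (fun x => expR (- x))
| exptrig_sin : exptrig w (fun x => sin (w * x))
| exptrig_cos : exptrig w (fun x => cos (w * x))
| exptrig_add p q :
    exptrig w p -> exptrig w q -> exptrig w (fun x => p x + q x)
| exptrig_mul p q :
    exptrig w p -> exptrig w q -> exptrig w (fun x => p x * q x).

Lemma is_derive_comp (R : realType) (f g : R -> R) (x df dg : R) :
  is_derive (g x) 1 f df -> is_derive x 1 g dg ->
  is_derive x 1 (fun t => f (g t)) (df * dg).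
Proof. by move=> ? ?; exact: is_derive1_comp. Qed.

Lemma is_derive_lin (R : realType) (w x : R) :
  is_derive x 1 (fun t => w * t) w.
Proof.
apply: (is_derive_eq (is_deriveZ w (is_derive_id x 1))).
by rewrite /GRing.scale /= mulr1.
Qed.

Lemma exptrig_derive (R : realType) (w : R) (p : R -> R) : exptrig w p ->
  exists2 q, exptrig w q & forall x : R, is_derive x 1 p (q x).
Proof.
elim=> {p} [c| | | | | |p q _ [p' Mp' dp] _ [q' Mq' dq]|
            p q Mp [p' Mp' dp] Mq [q' Mq' dq]].
- by exists (fun=> 0) => [|x]; [constructor|exact: is_derive_cst].
- by exists (fun=> 1) => [|x]; [constructor|exact: is_derive_id].
- by exists expR => [|x]; [constructor|exact: is_derive_expR].
- exists (fun x => -1 * expR (- x)) => [|x]; first by do !constructor.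
  rewrite mulrC.
  exact: is_derive_comp (is_derive_expR _) (is_deriveNid _ _).
- exists (fun x => w * cos (w * x)) => [|x]; first by do !constructor.
  rewrite mulrC.
  exact: is_derive_comp (is_derive_sin _) (is_derive_lin _ _).
- exists (fun x => (- w) * sin (w * x)) => [|x]; first by do !constructor.
  rewrite mulNr -mulrN mulrC.
  exact: is_derive_comp (is_derive_cos _) (is_derive_lin _ _).
- exists (fun x => p' x + q' x) => [|x]; first by constructor.
  exact: is_deriveD.
- exists (fun x => p x * q' x + q x * p' x) => [|x]; first by do !constructor.
  exact: is_deriveM.
Qed.

(** The exponential scale absorbs every generator, and its exponents simply
    add up under sums and products. *)
Lemma exptrig_bound (R : realType) (w : R) (p : R -> R) : exptrig w p ->
  exists C N, [/\ 0 <= C, 0 <= N & forall x, `|p x| <= C * expR (N * `|x|)].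
Proof.
have e1 (N x : R) : 0 <= N -> 1 <= expR (N * `|x|).
  by move=> N0; rewrite -expR0 ler_expR mulr_ge0.
elim=> {p} [c| | | | | |p q _ [C [N [C0 N0 pC]]] _ [D [M [D0 M0 qD]]]|
            p q _ [C [N [C0 N0 pC]]] _ [D [M [D0 M0 qD]]]].
- by exists `|c|, 0; split=> // x; rewrite mul0r expR0 mulr1.
- exists 1, 1; split=> // x; rewrite !mul1r.
  by have := expR_ge1Dx `|x|; lra.
- exists 1, 1; split=> // x; rewrite !mul1r ger0_norm ?expR_ge0//.
  by rewrite ler_expR ler_norm.
- exists 1, 1; split=> // x; rewrite !mul1r ger0_norm ?expR_ge0//.
  by rewrite ler_expR -normrN ler_norm.
- exists 1, 0; split=> // x.
  by rewrite mul1r mul0r expR0 ler_norml sin_geN1 sin_le1.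
- exists 1, 0; split=> // x.
  by rewrite mul1r mul0r expR0 ler_norml cos_geN1 cos_le1.
- exists (C + D), (N + M); split; [lra|lra|] => x.
  apply: (le_trans (ler_normD _ _)); rewrite mulrDl; apply: lerD.
  + apply: (le_trans (pC x)); rewrite ler_wpM2l// ler_expR ler_wpM2r//; lra.
  + apply: (le_trans (qD x)); rewrite ler_wpM2l// ler_expR ler_wpM2r//; lra.
- exists (C * D), (N + M); split; [exact: mulr_ge0|lra|] => x.
  by rewrite normrM mulrDl expRD mulrACA; apply: ler_pM.
Qed.

(** * Gaussian bumps in the logit coordinate *)

Section Bump.
Context {R : realType} (a b w : R).

Definition logit (t : R) : R := ln ((t - a) / (b - t)).

Definition bump (p : R -> R) (t : R) : R :=
  if a < t < b then expR (- logit t ^+ 2) * p (logit t) else 0.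

Lemma bumpE p t : a < t < b ->
  bump p t = expR (- logit t ^+ 2) * p (logit t).
Proof. by rewrite /bump => ->. Qed.

Lemma bump_out p t : ~~ (a < t < b) -> bump p t = 0.
Proof. by rewrite /bump => /negbTE ->. Qed.

Lemma eq_bump p q : p =1 q -> bump p =1 bump q.
Proof. by move=> pq t; rewrite /bump pq. Qed.

Lemma bumpD p q t : bump (fun x => p x + q x) t = bump p t + bump q t.
Proof. by rewrite /bump; case: ifP => _; rewrite ?mulrDr ?addr0. Qed.

Lemma bumpZ c p t : bump (fun x => c * p x) t = c * bump p t.
Proof. by rewrite /bump; case: ifP => _; rewrite ?mulr0// mulrCA. Qed.

Lemma expR_logit t : a < t < b -> expR (logit t) = (t - a) / (b - t).
Proof.
by move=> /andP[ta tb]; rewrite lnK// posrE divr_gt0// subr_gt0.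
Qed.

Lemma expR_logitN t : a < t < b -> expR (- logit t) = (b - t) / (t - a).
Proof. by move=> tab; rewrite expRN expR_logit// invf_div. Qed.

(** The derivative of [logit] is [jac (logit t) / (b - a)], by
    [is_derive_logit]; expressed through the logit itself it is again an
    [exptrig] function. *)
Definition jac (x : R) : R := 2 + expR x + expR (- x).

Lemma exptrig_jac : exptrig w jac.
Proof. by do !constructor. Qed.

Lemma jac_logit t : a < t < b ->
  jac (logit t) = (b - a) ^+ 2 / ((t - a) * (b - t)).
Proof.
move=> tab; rewrite /jac expR_logit// expR_logitN//.
case/andP: tab => ta tb.
by field; apply/andP; split; lra.
Qed.

Lemma is_derive_logit t : a < t < b ->
  is_derive t 1 logit (jac (logit t) / (b - a)).
Proof.
move=> tab; have [ta tb] := andP tab.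
have ta' : t - a != 0 by lra.
have tb' : b - t != 0 by lra.
have dn : is_derive t 1 (fun s => s - a) 1.
  apply: (is_derive_eq (is_deriveB (is_derive_id t 1) (is_derive_cst a t 1))).
  by rewrite subr0.
have dd : is_derive t 1 (fun s => b - s) (-1).
  apply: (is_derive_eq (is_deriveB (is_derive_cst b t 1) (is_derive_id t 1))).
  by rewrite sub0r.
have q0 : 0 < (t - a) / (b - t) by rewrite divr_gt0 ?subr_gt0.
have dq : is_derive t 1 (fun s => (s - a) / (b - s)) ((b - a) / (b - t) ^+ 2).
  have dv := @is_deriveV _ (fun s => b - s) t (-1) 1 tb' dd.
  apply: (is_derive_eq (is_deriveM dn dv)).
  by rewrite /GRing.scale /=; field.
have dl := is_derive1_ln q0.
have dc : is_derive t 1 logit _ :=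
  is_derive_comp (g := fun s => (s - a) / (b - s)) dl dq.
apply: (is_derive_eq dc).
by rewrite jac_logit//; field; apply/and3P; split; lra.
Qed.

(** [1 / (t - a)] is an [exptrig] function of the logit, so a factor vanishing
    at the end point [a] can be extracted from any bump, as often as desired. *)
Lemma bump_factorl p t :
  bump p t = (t - a) * bump (fun x => (b - a)^-1 * (p x * (1 + expR (- x)))) t.
Proof.
rewrite /bump; case: ifPn => [tab|_]; last by rewrite mulr0.
rewrite expR_logitN//; case/andP: tab => ta tb.
by field; apply/andP; split; lra.
Qed.

Lemma bump_factorr p t :
  bump p t = (b - t) * bump (fun x => (b - a)^-1 * (p x * (1 + expR x))) t.
Proof.
rewrite /bump; case: ifPn => [tab|_]; last by rewrite mulr0.
rewrite expR_logit//; case/andP: tab => ta tb.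
by field; apply/andP; split; lra.
Qed.

(** The Gaussian beats every exponential: [N * y - y ^+ 2 <= N ^+ 2]. *)
Lemma bump_bounded p : exptrig w p -> exists C, forall t, `|bump p t| <= C.
Proof.
move=> /exptrig_bound [C [N [C0 N0 pC]]].
exists (C * expR (N ^+ 2)) => t.
rewrite /bump; case: ifPn => [tab|_]; last by rewrite normr0 mulr_ge0 ?expR_ge0.
set x := logit t; rewrite normrM ger0_norm ?expR_ge0//.
apply: (le_trans (ler_wpM2l (expR_ge0 _) (pC x))).
rewrite mulrCA ler_wpM2l// -expRD ler_expR -real_normK ?num_real//.
have := normr_ge0 x; set y := `|x| => y0; nra.
Qed.

(** Two factors [t - a] (or [b - t]) extracted from a bump leave a bump, which
    is bounded; for [c] beyond an end point the estimate is only weaker. *)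
Lemma bump_flat p c : exptrig w p -> ~~ (a < c < b) ->
  exists2 C, 0 <= C & forall t, `|bump p t| <= C * (t - c) ^+ 2.
Proof.
move=> Mp cab.
have [ca|ac] := leP c a.
- pose q x := (b - a)^-1 * (p x * (1 + expR (- x))).
  pose r x := (b - a)^-1 * (q x * (1 + expR (- x))).
  have /bump_bounded[C rC] : exptrig w r by do !constructor.
  have C0 : 0 <= C by apply: le_trans (rC a).
  exists C => // t.
  have [tab|/bump_out->] := boolP (a < t < b); last first.
    by rewrite normr0 mulr_ge0// sqr_ge0.
  have /andP[ta tb] := tab.
  rewrite bump_factorl (bump_factorl (fun x => _)) -/q -/r mulrA -expr2 mulrC.
  rewrite normrM [X in _ * X]ger0_norm ?sqr_ge0//.
  by rewrite ler_pM// ?sqr_ge0// ler_sqr ?nnegrE; lra.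
- pose q x := (b - a)^-1 * (p x * (1 + expR x)).
  pose r x := (b - a)^-1 * (q x * (1 + expR x)).
  have /bump_bounded[C rC] : exptrig w r by do !constructor.
  have C0 : 0 <= C by apply: le_trans (rC a).
  exists C => // t.
  have [tab|/bump_out->] := boolP (a < t < b); last first.
    by rewrite normr0 mulr_ge0// sqr_ge0.
  have /andP[ta tb] := tab.
  rewrite bump_factorr (bump_factorr (fun x => _)) -/q -/r mulrA -expr2 mulrC.
  rewrite normrM [X in _ * X]ger0_norm ?sqr_ge0//.
  have bc : b <= c by move: cab; rewrite ac /= -leNgt.
  rewrite ler_pM// ?sqr_ge0// -[leRHS]sqrrN ler_sqr ?nnegrE; lra.
Qed.

Lemma is_derive_flat (f : R -> R) (c C : R) : 0 <= C ->
  (forall t, `|f t| <= C * (t - c) ^+ 2) -> is_derive c 1 f 0.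
Proof.
move=> C0 fC.
have fc : f c = 0.
  by apply/eqP; rewrite -normr_le0 (le_trans (fC c))// subrr expr0n mulr0.
have cv : h^-1 *: (f (h *: 1 + c) - f c) @[h --> 0^'] --> (0 : R).
  apply/cvgr0Pnorm_le => /= e e0; near=> h.
  have h0 : h != 0 by near: h; exact: nbhs_dnbhs_neq.
  rewrite fc subr0 normrZ normfV ler_pdivrMl ?normr_gt0//.
  apply: (le_trans (fC _)); rewrite /GRing.scale /= mulr1 addrK.
  rewrite -real_normK ?num_real// expr2 mulrCA ler_wpM2l//.
  have hC : `|h| <= e / (C + 1).
    near: h; apply: dnbhs0_le; rewrite divr_gt0//; lra.
  apply: (le_trans (ler_wpM2l C0 hC)).
  rewrite mulrCA ler_piMr ?(ltW e0)// ler_pdivrMr; lra.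
constructor; first by apply/cvg_ex; exists 0.
exact: cvg_lim.
Unshelve. all: by end_near. Qed.

(** Inside ]a, b[ this is the chain rule; at all other points a bump is flat
    to second order. *)
Lemma exptrig_bump_derive p : exptrig w p ->
  exists2 q, exptrig w q & forall t : R, is_derive t 1 (bump p) (bump q t).
Proof.
move=> Mp; have [p' Mp' dp] := exptrig_derive Mp.
exists (fun x => (p' x + (-2) * (x * p x)) * (jac x * (b - a)^-1)) => [|t].
  have := exptrig_jac; do !constructor => //.
have [tab|tab] := boolP (a < t < b); last first.
  rewrite bump_out//; have [C C0 /is_derive_flat] := bump_flat Mp tab; exact.
have du := is_derive_logit tab.
have de : is_derive t 1 (fun s => expR (- logit s ^+ 2))
    (expR (- logit t ^+ 2) * (- (logit t * (jac (logit t) / (b - a)) *+ 2))).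
  apply: (is_derive_comp (g := fun s => - logit s ^+ 2) (is_derive_expR _)).
have dm := is_deriveM de (is_derive_comp (dp (logit t)) du).
pose fp s := expR (- logit s ^+ 2) * p (logit s).
have fpE : \forall s \near t, fp s = bump p s.
  have /andP[ta tb] := tab.
  near=> s; rewrite bumpE//; apply/andP; split; near: s.
  - exact: lt_nbhsr.
  - exact: lt_nbhsl.
have dF : is_derive t 1 fp _ := dm.
apply: (is_derive_eq (near_eq_is_derive fpE dF)).
by rewrite bumpE// /GRing.scale /=; ring.
Unshelve. all: by end_near. Qed.

Lemma smooth_bump p : exptrig w p -> smooth (bump p).
Proof.
move=> Mp n.
have [q Mq ->] : exists2 q, exptrig w q & derive1n n (bump p) = bump q.
  elim: n => [|n [q Mq IH]]; first by exists p.
  have [r Mr dr] := exptrig_bump_derive Mq.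
  exists r => //; rewrite derive1nS IH; apply/funext => t.
  by rewrite derive1E; have [_ ->] := dr t.
by have [r _ dr] := exptrig_bump_derive Mq => x; have [] := dr x.
Qed.

Lemma continuous_bump p : exptrig w p -> continuous (bump p).
Proof.
move=> Mp x; apply/differentiable_continuous/derivable1_diffP.
by have [q _ dq] := exptrig_bump_derive Mp; have [] := dq x.
Qed.

Lemma fun_supp_bump p : fun_supp (bump p) `<=` `[a, b].
Proof.
rewrite /fun_supp closureE; apply: smallest_sub; first exact: itv_closed.
move=> t /=; apply: contraR => tab; rewrite bump_out//.
by apply: contra tab => /andP[ta tb]; rewrite in_itv /= !ltW.
Qed.
End Bump.

(** * Probability measures given by a density *)

Lemma exists_density_probability (R : realType) (f : R -> R) :
  measurable_fun [set: measurableTypeR R] (f : measurableTypeR R -> R) ->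
  (forall x, 0 <= f x) ->
  (\int[lebesgue_measure]_x (f x)%:E = 1)%E ->
  exists mu : probability (measurableTypeR R) R, is_density mu f.
Proof.
move=> mf f0 f1.
have mfE (A : set (measurableTypeR R)) :
    measurable_fun A (EFin \o f : measurableTypeR R -> \bar R).
  by apply/measurable_funTS/measurable_EFinP.
pose m (A : set (measurableTypeR R)) : \bar R :=
  (\int[lebesgue_measure]_(x in A) (f x)%:E)%E.
have m0 : m set0 = 0%E by rewrite /m integral_set0.
have mge A : (0 <= m A)%E by apply: integral_ge0 => x _; rewrite lee_fin.
have msig : semi_sigma_additive m.
  move=> F mF tF mUF; rewrite /m ge0_integral_bigcup//=; last first.
    by move=> x _; rewrite lee_fin.
  by apply: is_cvg_nneseries => n _ _; exact: mge.
pose mM := isMeasure.Build _ _ _ m m0 mge msig.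
pose M : {measure set (measurableTypeR R) -> \bar R} := HB.pack m mM.
pose mP := Measure_isProbability.Build _ _ _ M f1.
pose P : probability (measurableTypeR R) R := HB.pack m mM mP.
by exists P; split.
Qed.

Section Density.
Context {R : realType} (mu : probability (measurableTypeR R) R) (f : R -> R).
Hypothesis muf : is_density mu f.

Lemma density_dominates : mu `<< (@lebesgue_measure R).
Proof.
have [mf f0 muE] := muf; apply/null_content_dominatesP => A mA A0.
rewrite muE//; apply: null_set_integral => //.
exact/measurable_funTS/measurable_EFinP.
Qed.

(** The Radon-Nikodym derivative of [mu] agrees almost everywhere with [f]. *)
Lemma density_integral (g : R -> R) (A : set (measurableTypeR R)) :
  measurable A ->
  mu.-integrable A (EFin \o g) ->
  (\int[mu]_(x in A) (g x)%:E =
   \int[lebesgue_measure]_(x in A) (g x * f x)%:E)%E.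
Proof.
have [mf f0 muE] := muf => mA ig.
rewrite -(Radon_Nikodym_change_of_variables density_dominates mA ig).
have mg := measurable_int _ ig.
have RNi := Radon_Nikodym_integrable
  (nu := charge_of_finite_measure mu) density_dominates.
apply: ae_eq_integral => //.
- apply: emeasurable_funM => //; apply: measurable_funTS.
  exact: measurable_int RNi.
- rewrite (_ : (fun x => _) =
             (fun x => (EFin \o g) x * (f x)%:E)%E); last exact/funext.
  apply: emeasurable_funM => //.
  exact/measurable_funTS/measurable_EFinP.
rewrite (_ : (fun x => (g x * f x)%:E) =
             (fun x => (EFin \o g) x * (EFin \o f) x)%E); last exact/funext.
apply: ae_eqe_mul2l.
apply: integral_ae_eq => //.
- exact: integrableS RNi.
- exact/measurable_funTS/measurable_EFinP.
- move=> E EA mE.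
  rewrite -(Radon_Nikodym_integral
    (nu := charge_of_finite_measure mu) density_dominates mE).
  exact: muE.
Qed.
End Density.

(** * Integrals of continuous functions over a segment *)

Section SegmentIntegral.
Context {R : realType} (a b : R).
Local Notation I f := (\int[@lebesgue_measure R]_(x in `[a, b]) (f x)).

Lemma continuous_segment_integrable (f : R -> R) : continuous f ->
  (@lebesgue_measure R).-integrable `[a, b] (EFin \o f).
Proof.
move=> cf; apply: continuous_compact_integrable; first exact: segment_compact.
exact: continuous_subspaceT.
Qed.

Lemma segment_integral_ge (f : R -> R) (x y C c : R) : continuous f ->
  a <= x -> x <= y -> y <= b ->
  (forall t, a <= t <= b -> - C <= f t) ->
  (forall t, x <= t <= y -> c - C <= f t) ->
  c * (y - x) - C * (b - a) <= I f.
Proof.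
move=> cf ax xy yb fC fc.
have mD : measurable (`[a, b] : set (measurableTypeR R)) by [].
have mE : measurable (`[x, y] : set (measurableTypeR R)) by [].
have iC (k : R) : (@lebesgue_measure R).-integrable `[a, b] (EFin \o (fun=> k)).
  by apply: continuous_segment_integrable => t; exact: cvg_cst.
have i1 : (@lebesgue_measure R).-integrable `[a, b]
    (EFin \o (fun t => c * \1_(`[x, y] : set R) t)).
  rewrite (_ : _ \o _ = (fun t => c%:E *
    (EFin \o \1_(`[x, y] : set R)) t)%E); last exact/funext.
  apply: integrableZl => //.
  apply: (@integrableS _ _ _ _ setT) => //.
  exact: integrable_indic_itv.
have cst_int (k u v : R) : u <= v ->
    \int[@lebesgue_measure R]_(t in `[u, v]) k = k * (v - u).
  move=> uv; rewrite Rintegral_cst//= lebesgue_measure_itv/= lte_fin.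
  by move: uv; rewrite le_eqVlt => /predU1P[->|->//]; rewrite ltxx subrr.
have -> : c * (y - x) - C * (b - a) =
    I (fun t => c * \1_(`[x, y] : set R) t - C).
  rewrite RintegralB//= RintegralZl//=; last first.
    by apply: (@integrableS _ _ _ _ setT) => //; exact: integrable_indic_itv.
  rewrite cst_int; last by rewrite (le_trans ax)// (le_trans xy).
  congr (_ * _ - _); rewrite /Rintegral integral_indic// setIidl; last first.
    by apply: subset_itv; rewrite bnd_simp.
  by rewrite -[LHS]mul1r -cst_int// Rintegral_cst// mul1r.
apply: le_Rintegral => //.
- exact: (integrableB mD i1 (iC C)).
- exact: continuous_segment_integrable.
- move=> t; rewrite /= in_itv /= => tab; rewrite indicE.
  case: (boolP (t \in _)) => [|_]; last by rewrite mulr0 sub0r fC.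
  by rewrite inE /= in_itv /= mulr1 => /fc.
Qed.
End SegmentIntegral.

(** * Reflection of the logit *)

Section Reflection.
Context {R : realType} (a b k : R).
Hypotheses (ab : a < b) (k0 : 0 < k).

Let den (t : R) := (t - a) + k * (b - t).

(** The homography of [a, b] which exchanges [a] and [b] and acts on the logit
    by [u -> ln k - u]. *)
Definition flip (t : R) : R := (a * (t - a) + b * (k * (b - t))) / den t.

Definition dflip (t : R) : R := - (k * (b - a) ^+ 2 / den t ^+ 2).

Let den_gt0 t : a <= t <= b -> 0 < den t.
Proof.
move=> /andP[]; rewrite le_eqVlt => /predU1P[<- _|ta tb].
  by rewrite /den subrr add0r mulr_gt0// subr_gt0.
by rewrite /den ltr_pwDl ?subr_gt0// mulr_ge0 ?subr_ge0// ltW.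
Qed.

Lemma flip_l : flip a = b.
Proof.
have := @den_gt0 a; rewrite lexx ltW// => /(_ isT) d0.
rewrite /flip; move: d0; rewrite /den subrr mulr0 !add0r => d0.
by rewrite mulfK// gt_eqF.
Qed.

Lemma flip_r : flip b = a.
Proof.
by rewrite /flip /den subrr !mulr0 !addr0 mulfK// subr_eq0 gt_eqF.
Qed.

Lemma flip_decr : {in `[a, b] &, {homo flip : x y /~ x < y}}.
Proof.
move=> x y; rewrite !in_itv /= => /den_gt0 dx /den_gt0 dy xy.
rewrite -subr_gt0.
have -> : flip y - flip x = k * (b - a) ^+ 2 * (x - y) / (den x * den y).
  rewrite /flip; have := gt_eqF dx; have := gt_eqF dy; rewrite /den => d1 d2.
  by field; rewrite d1 d2.
by rewrite divr_gt0 ?mulr_gt0 ?exprn_gt0 ?subr_gt0.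
Qed.

Lemma is_derive_flip t : den t != 0 -> is_derive t 1 flip (dflip t).
Proof.
move=> d0.
have dt : is_derive t 1 (fun s => s - a) 1.
  apply: (is_derive_eq (is_deriveB (is_derive_id t 1) (is_derive_cst a t 1))).
  by rewrite subr0.
have db : is_derive t 1 (fun s => b - s) (-1).
  apply: (is_derive_eq (is_deriveB (is_derive_cst b t 1) (is_derive_id t 1))).
  by rewrite sub0r.
have dd : is_derive t 1 den (1 + k *: (-1)) := is_deriveD dt (is_deriveZ k db).
have dn : is_derive t 1 (fun s => a * (s - a) + b * (k * (b - s))) _ :=
  is_deriveD (is_deriveZ a dt) (is_deriveZ b (is_deriveZ k db)).
have dv := @is_deriveV _ den t _ 1 d0 dd.
have dr : is_derive t 1 flip _ := is_deriveM dn dv.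
apply: (is_derive_eq dr).
rewrite /GRing.scale /= /dflip; move: d0; rewrite /den => d0; field.
exact: d0.
Qed.

Let cden : continuous den.
Proof.
move=> t; apply: cvgD; first by apply: cvgB; [exact: cvg_id|exact: cvg_cst].
by apply: cvgM; [exact: cvg_cst|apply: cvgB; [exact: cvg_cst|exact: cvg_id]].
Qed.

Let near_den t : den t != 0 -> \forall s \near t, den s != 0.
Proof.
by move=> d0; exact: (cvgr_neq0 (den t) (@cden t) d0).
Qed.

Lemma continuous_dflip t : den t != 0 ->
  derive1 flip x @[x --> t] --> dflip t.
Proof.
move=> d0.
have : dflip x @[x --> t] --> dflip t.
  apply: cvgN; apply: cvgM; first exact: cvg_cst.
  apply: cvgV; first by rewrite expf_neq0.
  rewrite expr2; under eq_fun do rewrite expr2.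
  by apply: cvgM; exact: cden.
apply: cvg_trans; apply: near_eq_cvg.
near=> s; rewrite derive1E; have ds : den s != 0 by near: s; exact: near_den.
by have [_ ->] := is_derive_flip ds.
Unshelve. all: by end_near. Qed.

Lemma logit_flip t : a < t < b ->
  a < flip t < b /\ logit a b (flip t) = ln k - logit a b t.
Proof.
move=> tab; have /andP[ta tb] := tab.
have d0 : 0 < den t by rewrite den_gt0// !ltW.
have ea : flip t - a = k * (b - a) * (b - t) / den t.
  by rewrite /flip; have := gt_eqF d0; rewrite /den => d1; field; apply/negbT.
have eb : b - flip t = (b - a) * (t - a) / den t.
  by rewrite /flip; have := gt_eqF d0; rewrite /den => d1; field; apply/negbT.
split.
  rewrite -subr_gt0 -(subr_gt0 (flip t)) ea eb.
  by rewrite !divr_gt0// !mulr_gt0// subr_gt0.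
rewrite /logit ea eb -lnV ?posrE ?divr_gt0 ?subr_gt0//.
rewrite -lnM ?posrE ?invr_gt0 ?divr_gt0 ?subr_gt0//.
congr ln; move: d0; rewrite /den => d0; field.
by apply/and3P; split; lra.
Qed.

(** Because [logit (flip t) = ln k - logit t], the Jacobian of [flip] turns
    [jac (logit (flip t))] back into [jac (logit t)]. *)
Lemma bump_jac_flip p t : a < t < b ->
  bump a b (fun x => p x * jac x) (flip t) * - dflip t =
  expR (- (ln k - logit a b t) ^+ 2) * p (ln k - logit a b t) *
  jac (logit a b t).
Proof.
move=> tab; have /andP[ta tb] := tab.
have [rab lr] := logit_flip tab.
have d0 : 0 < den t by rewrite den_gt0// !ltW.
rewrite bumpE// -lr !mulrA -!mulrA; congr (_ * (_ * _)).
rewrite !jac_logit//.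
have ea : flip t - a = k * (b - a) * (b - t) / den t.
  by rewrite /flip; have := gt_eqF d0; rewrite /den => d1; field; apply/negbT.
have eb : b - flip t = (b - a) * (t - a) / den t.
  by rewrite /flip; have := gt_eqF d0; rewrite /den => d1; field; apply/negbT.
rewrite ea eb /dflip; field.
by rewrite (gt_eqF d0) (gt_eqF k0) !subr_eq0 !gt_eqF.
Qed.

(** The substitution [t -> flip t] shows that the integral equals its
    opposite. *)
Lemma integral_antisymmetric w p : exptrig w p ->
  (forall x, expR (- (ln k - x) ^+ 2) * p (ln k - x) =
             - (expR (- x ^+ 2) * p x)) ->
  \int[@lebesgue_measure R]_(t in `[a, b])
    bump a b (fun x => p x * jac x) t = 0.
Proof.
move=> Mp asym.
set G := bump a b (fun x => p x * jac x).
have MG : exptrig w (fun x => p x * jac x).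
  by have := exptrig_jac; do !constructor.
have cG : continuous G by exact: continuous_bump MG.
have dab t : a <= t <= b -> den t != 0 by move=> /den_gt0/lt0r_neq0.
have da : den a != 0 by rewrite dab// lexx ltW.
have db : den b != 0 by rewrite dab// lexx ltW.
have cr t : den t != 0 -> flip x @[x --> t] --> flip t.
  move=> d0; apply: differentiable_continuous; apply/derivable1_diffP.
  by have [] := is_derive_flip d0.
have S : (\int[@lebesgue_measure R]_(t in `[a, b]) (G t)%:E =
          \int[@lebesgue_measure R]_(t in `[a, b])
             (((G \o flip) * - (derive1 flip)) t)%:E)%E.
  have := @integration_by_substitution_decreasing
    R flip G a b (ltW ab) flip_decr.
  rewrite flip_l flip_r; apply.
  - move=> t; rewrite in_itv /= => /andP[ta tb].
    have d0 : den t != 0 by rewrite dab// !ltW.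
    rewrite /continuous_at derive1E; have [_ ->] := is_derive_flip d0.
    exact: continuous_dflip.
  - apply/cvg_ex; exists (dflip a); apply: cvg_at_right_filter.
    exact: continuous_dflip.
  - apply/cvg_ex; exists (dflip b); apply: cvg_at_left_filter.
    exact: continuous_dflip.
  - split.
    + move=> t; rewrite in_itv /= => /andP[ta tb].
      have d0 : den t != 0 by rewrite dab// !ltW.
      by have [] := is_derive_flip d0.
    + by apply: cvg_at_right_filter; exact: cr.
    + by apply: cvg_at_left_filter; exact: cr.
  - exact: continuous_subspaceT.
have {}S : \int[@lebesgue_measure R]_(t in `[a, b]) G t =
           \int[@lebesgue_measure R]_(t in `[a, b]) (-1 * G t).
  rewrite /Rintegral S; congr fine; apply: eq_integral => t.
  rewrite inE /= in_itv /= => tab; congr (_%:E).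
  have -> : ((G \o flip) * - (derive1 flip)) t =
    G (flip t) * - derive1 flip t by [].
  rewrite derive1E; have [_ ->] := is_derive_flip (dab t tab).
  have [tin|tout] := boolP (a < t < b).
    by rewrite bump_jac_flip// /G bumpE// asym; ring.
  have -> : G t = 0 by exact: bump_out.
  rewrite [G _]bump_out ?mul0r ?mulr0//.
  have /andP[ta tb] := tab.
  have [->|->] : t = a \/ t = b.
    have [|ne] := eqVneq t a; first by left.
    right; apply/eqP; move: tout; rewrite !lt_def ta tb ne /= andbT negbK.
    by rewrite eq_sym.
  - by rewrite flip_l ltxx andbF.
  - by rewrite flip_r ltxx.
have iG := continuous_segment_integrable a b cG.
rewrite RintegralZl// mulN1r in S.
by move/eqP: S; rewrite -addr_eq0 -mulr2n mulrn_eq0 => /eqP.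
Qed.
End Reflection.

(** * Vanishing log-normal moments *)

Section Wave.
Context {R : realType} (a b : R).
Hypothesis ab : a < b.
Local Notation w := (pi *+ 2 : R).
Local Notation I f := (\int[@lebesgue_measure R]_(t in `[a, b]) (f t)).

Lemma exptrig_expX n : exptrig w (fun x : R => expR x ^+ n).
Proof.
elim: n => [|n IH].
  by rewrite (_ : (fun _ => _) = (fun=> 1)); [constructor|apply/funext => x].
rewrite (_ : (fun _ => _) = (fun x => expR x * expR x ^+ n)).
  by do !constructor.
by apply/funext => x; rewrite exprS.
Qed.

Definition wave (q : R -> R) (x : R) : R := sin (w * x) * q x.

Lemma exptrig_wave q : exptrig w q -> exptrig w (wave q).
Proof. by move=> ?; do !constructor. Qed.

(** Stieltjes' observation: [expR (- x ^+ 2) * expR x ^+ n] is invariant under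
    [x -> n - x], which changes the sign of [sin (2 pi x)] as [n] is an
    integer. *)
Lemma integral_wave_expX n :
  \int[@lebesgue_measure R]_(t in `[a, b])
    bump a b (fun x => wave (fun y => expR y ^+ n) x * jac x) t = 0.
Proof.
apply: (integral_antisymmetric ab (expR_gt0 n%:R)
  (exptrig_wave (exptrig_expX n))).
move=> x; rewrite /wave expRK mulrBr.
have -> : w * n%:R = w *+ n by rewrite mulr_natr.
rewrite [X in sin X]addrC (periodicn (@sinD2pi R)) sinN mulNr mulrN.
congr (- _).
rewrite !(mulrCA (expR _)); congr (_ * _).
by rewrite -!expRM_natl -!expRD; congr expR; ring.
Qed.

Lemma exptrig_expX_affine n K (c d : R) :
  exptrig w (fun y => expR y ^+ n * (c + d * expR y) ^+ K).
Proof.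
elim: K => [|K IH].
  rewrite (_ : (fun _ => _) = (fun x : R => expR x ^+ n)).
    exact: exptrig_expX.
  by apply/funext => x; rewrite expr0 mulr1.
rewrite (_ : (fun _ => _) = (fun x => (c + d * expR x) *
    (expR x ^+ n * (c + d * expR x) ^+ K))); last first.
  by apply/funext => x; rewrite exprS mulrCA.
by apply: exptrig_mul => //; do !constructor.
Qed.

Lemma integral_wave_affine n K (c d : R) :
  \int[@lebesgue_measure R]_(t in `[a, b])
    bump a b (fun x =>
      wave (fun y => expR y ^+ n * (c + d * expR y) ^+ K) x * jac x) t = 0.
Proof.
have Mj q : exptrig w q -> exptrig w (fun x => wave q x * jac x).
  by move=> ?; apply: exptrig_mul; [exact: exptrig_wave|exact: exptrig_jac].
have ib q : exptrig w q -> (@lebesgue_measure R).-integrable `[a, b]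
    (EFin \o bump a b q).
  move=> Mq; apply: continuous_segment_integrable.
  exact: continuous_bump Mq.
elim: K n => [|K IH] n.
  rewrite -[RHS](integral_wave_expX n); apply: eq_Rintegral => t _.
  by apply: eq_bump => x; rewrite /wave expr0 mulr1.
pose F k := bump a b (fun x =>
  wave (fun y => expR y ^+ k * (c + d * expR y) ^+ K) x * jac x).
transitivity (I (fun t => c * F n t + d * F n.+1 t)).
  apply: eq_Rintegral.
  move=> t _; rewrite /F -!bumpZ -bumpD; apply: eq_bump => x.
  by rewrite /wave !exprS; ring.
have iF k : (@lebesgue_measure R).-integrable `[a, b] (EFin \o F k).
  by apply/ib/Mj; exact: exptrig_expX_affine.
have iZ (e : R) k : (@lebesgue_measure R).-integrable `[a, b]
    (EFin \o (fun t => e * F k t)).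
  exact: (integrableZl _ e (iF k)).
by rewrite RintegralD// !RintegralZl// !IH !mulr0 addr0.
Qed.
End Wave.

(** * Nonnegative moments and a power series *)

Section Moments.
Context {R : realType} (a b : R) (h : R -> R).
Hypothesis ch : continuous h.
Local Notation I f := (\int[@lebesgue_measure R]_(t in `[a, b]) (f t)).

Let integrable_mul (g : R -> R) : continuous g ->
  (@lebesgue_measure R).-integrable `[a, b] (EFin \o (fun t => h t * g t)).
Proof.
move=> cg; apply: continuous_segment_integrable => t.
by apply: cvgM; [exact: ch|exact: cg].
Qed.

Lemma integral_mul_horner (p : {poly R}) n : (size p <= n)%N ->
  I (fun t => h t * p.[t]) = \sum_(i < n) p`_i * I (fun t => h t * t ^+ i).
Proof.
move=> pn.
transitivity (I (fun t => h t * \sum_(i < n) p`_i * t ^+ i)).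
  apply: eq_Rintegral; by move=> t _; rewrite (horner_coef_wide _ pn).
have cX i : continuous (fun t : R => t ^+ i) by exact: exprn_continuous.
have cS k : continuous (fun t : R => \sum_(i < k) p`_i * t ^+ i).
  elim: k => [|k IH].
    rewrite (_ : (fun _ => _) = (fun=> 0)); first by move=> t; exact: cvg_cst.
    by apply/funext => t; rewrite big_ord0.
  rewrite (_ : (fun _ => _) =
               (fun t => \sum_(i < k) p`_i * t ^+ i + p`_k * t ^+ k)).
    move=> t; apply: cvgD; first exact: IH.
    by apply: cvgM; [exact: cvg_cst|exact: cX].
  by apply/funext => t; rewrite big_ord_recr.
elim: n {pn} => [|n IH].
  transitivity (I (fun=> 0)).
    apply: eq_Rintegral; by move=> t _; rewrite big_ord0 mulr0.
  by rewrite Rintegral_cst// mul0r big_ord0.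
rewrite big_ord_recr/= -IH -RintegralZl//; last exact: integrable_mul.
rewrite -RintegralD//; last 2 first.
- exact: integrable_mul.
- exact: (integrableZl _ _ (integrable_mul (cX n))).
by apply: eq_Rintegral => t _; rewrite big_ord_recr/=; ring.
Qed.
End Moments.

Lemma cvg_exprn (R : realType) (u : nat -> R) (l : R) n :
  u J @[J --> \oo] --> l -> u J ^+ n @[J --> \oo] --> l ^+ n.
Proof. by move=> ul; exact: cvg_comp ul (@exprn_continuous R n l). Qed.

Section GeometricPowers.
Context {R : realType} (c : R).
Hypothesis c0 : 0 < c.

Definition geom_poly (J : nat) : {poly R} := \poly_(j < J) c ^+ j.

Lemma coef_geom_pow_ge0 J K i : 0 <= (geom_poly J ^+ K)`_i.
Proof.
elim: K i => [|K IH] i; first by rewrite expr0 coef1 ler0n.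
rewrite exprS coefM sumr_ge0// => j _; rewrite mulr_ge0// coef_poly.
by case: ifP => // _; rewrite exprn_ge0// ltW.
Qed.

(** One factor contributes [c ^+ i], all the others their constant term [1]. *)
Lemma coef_geom_pow_ge J K i : (i < J)%N -> c ^+ i <= (geom_poly J ^+ K.+1)`_i.
Proof.
move=> iJ; rewrite exprS coefM big_ord_recr/= subnn coef_poly iJ.
have -> : (geom_poly J ^+ K)`_0 = 1.
  rewrite -horner_coef0 horner_exp horner_coef0 coef_poly.
  by rewrite (leq_ltn_trans (leq0n i) iJ) expr0 expr1n.
rewrite mulr1 lerDr sumr_ge0// => j _; rewrite mulr_ge0 ?coef_geom_pow_ge0//.
by rewrite coef_poly; case: ifP => // _; rewrite exprn_ge0// ltW.
Qed.

Lemma horner_geom_poly J t : (geom_poly J).[t] = \sum_(j < J) (c * t) ^+ j.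
Proof. by rewrite horner_poly; apply: eq_bigr => j _; rewrite exprMn. Qed.
End GeometricPowers.

Section GeneratingFunction.
Context {R : realType} (a b : R) (h : R -> R) (K : nat).
Hypotheses (a0 : 0 <= a) (ab : a < b) (ch : continuous h) (hb : h b = 0).
Local Notation I f := (\int[@lebesgue_measure R]_(t in `[a, b]) (f t)).
Local Notation W t := (h t * (t / (1 - b^-1 * t)) ^+ K.+1).
Hypothesis cW : continuous (fun t => W t).

(* Truncations of the power series of [(t / (1 - t / b)) ^+ K.+1]. *)
Let P J : {poly R} := 'X ^+ K.+1 * geom_poly b^-1 J ^+ K.+1.

Let b0 : 0 < b. Proof. exact: le_lt_trans ab. Qed.
Let c0 : 0 < b^-1. Proof. by rewrite invr_gt0. Qed.

(** The truncations increase to their limit on [0, b[, so that [`|W t|]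
    dominates. The singularity at [b] is harmless: [h b = 0], and [W] is
    continuous. *)
Lemma cvg_integral_geom_pow :
  I (fun t => h t * (P J).[t]) @[J --> \oo] --> I (fun t => W t).
Proof.
have mD : measurable (`[a, b] : set (measurableTypeR R)) by [].
have iW := continuous_segment_integrable a b cW.
have geo t : 0 <= t < b ->
    (\sum_(j < J) (b^-1 * t) ^+ j : R) @[J --> \oo] --> (1 - b^-1 * t)^-1.
  move=> /andP[t0 tb].
  have := @cvg_geometric_series R 1 (b^-1 * t); rewrite mul1r.
  rewrite ger0_norm ?mulr_ge0 ?invr_ge0 ?(ltW b0)// ltr_pdivrMl// mulr1 tb.
  move=> /(_ isT); rewrite /series /=.
  by under eq_fun do rewrite big_mkord (eq_bigr _ (fun _ _ => mul1r _)).
have PE J t : (P J).[t] = (t * \sum_(j < J) (b^-1 * t) ^+ j) ^+ K.+1.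
  by rewrite /P hornerM hornerXn horner_exp horner_geom_poly -exprMn.
have PW J t : 0 <= t < b -> `|h t * (P J).[t]| <= `|W t|.
  move=> tb; have /andP[t0 tb'] := tb.
  rewrite PE !normrM ler_wpM2l//.
  have ct0 : 0 <= b^-1 * t by rewrite mulr_ge0// ltW.
  have ct1 : 0 < 1 - b^-1 * t by rewrite subr_gt0 ltr_pdivrMl// mulr1.
  have s0 : 0 <= \sum_(j < J) (b^-1 * t) ^+ j.
    by rewrite sumr_ge0// => j _; rewrite exprn_ge0.
  rewrite !ger0_norm ?exprn_ge0 ?mulr_ge0 ?invr_ge0 ?(ltW ct1)//.
  rewrite lerXn2r ?nnegrE ?mulr_ge0 ?invr_ge0 ?(ltW ct1)// ler_wpM2l//.
  rewrite -[leRHS]mul1r ler_pdivlMr//.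
  have := subrX1 (b^-1 * t) J; have := exprn_ge0 J ct0; lra.
have cvP t : 0 <= t <= b -> h t * (P J).[t] @[J --> \oo] --> W t.
  move=> /andP[t0]; rewrite le_eqVlt => /predU1P[->|tb].
    by rewrite hb !mul0r; under eq_fun do rewrite mul0r; exact: cvg_cst.
  apply: cvgM; first exact: cvg_cst.
  under eq_fun do rewrite PE.
  apply: cvg_exprn.
  by apply: cvgM; [exact: cvg_cst|apply: geo; rewrite t0].
have mP J : (@lebesgue_measure R).-integrable `[a, b]
    (EFin \o (fun t => h t * (P J).[t])).
  apply: continuous_segment_integrable => t.
  by apply: cvgM; [exact: ch|exact: continuous_horner].
pose F J t := (h t * (P J).[t])%:E.
have Fcv : {ae @lebesgue_measure R, forall t, `[a, b]%classic t ->
    F ^~ t @ \oo --> (W t)%:E}.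
  apply: aeW => t; rewrite /= in_itv /= => /andP[at_ tb].
  by apply: cvg_EFin; [exact: nearW|apply: cvP; rewrite (le_trans a0)].
have Fdom : {ae @lebesgue_measure R, forall t J, `[a, b]%classic t ->
    (`|F J t| <= `|(W t)%:E|)%E}.
  apply: aeW => t J; rewrite /= in_itv /= => /andP[at_].
  rewrite le_eqVlt => /predU1P[->|tb]; first by rewrite /F hb !mul0r.
  by rewrite lee_fin PW// (le_trans a0).
have [_ _ H] := dominated_convergence mD (fun J => measurable_int _ (mP J))
  (measurable_int _ iW) Fcv (integrable_abse iW) Fdom.
by apply: fine_cvg; rewrite fineK//; exact: integrable_fin_num.
Qed.

(** Zero is the limit of combinations of nonnegative moments in which the
    coefficient of the [k]-th one stays above a positive constant. *)
Lemma moments_eq0 : I (fun t => W t) = 0 ->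
  (forall k, (K < k)%N -> 0 <= I (fun t => h t * t ^+ k)) ->
  forall k, (K < k)%N -> I (fun t => h t * t ^+ k) = 0.
Proof.
move=> W0 m0 k Kk; apply/eqP; rewrite eq_le m0// andbT.
suff : b^-1 ^+ (k - K.+1) * I (fun t => h t * t ^+ k) <= 0.
  by rewrite pmulr_rle0// exprn_gt0.
rewrite -W0; apply: (cvgr_to_ge cvg_integral_geom_pow).
exists k.+1 => // J /= kJ.
pose n := maxn (size (P J)) k.+1.
rewrite (integral_mul_horner _ _ ch (leq_maxl (size (P J)) k.+1)) -/n.
have kn : (k < n)%N by rewrite leq_maxr.
rewrite (bigD1 (Ordinal kn))//= /P coefXnM ltnNge Kk/= -[leLHS]addr0 lerD//.
  rewrite ler_wpM2r ?m0// coef_geom_pow_ge//.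
  exact: leq_ltn_trans (leq_subr _ _) kJ.
apply: sumr_ge0 => i _; rewrite coefXnM.
case: ltnP => [|Ki]; first by rewrite mul0r.
by rewrite mulr_ge0 ?m0// coef_geom_pow_ge0.
Qed.
End GeneratingFunction.

(** * A continuous function with vanishing moments *)

Lemma bernoulli_ineq (R : realDomainType) (x : R) n : 0 <= x ->
  1 + n%:R * x <= (1 + x) ^+ n.
Proof.
move=> x0; elim: n => [|n IH]; first by rewrite mul0r addr0 expr0.
have nx : 0 <= n%:R * x by rewrite mulr_ge0.
rewrite exprS -natr1; apply: le_trans (ler_wpM2l _ IH); nra.
Qed.

Section Peak.
Context {R : realType} (a b : R).
Local Notation I f := (\int[@lebesgue_measure R]_(t in `[a, b]) (f t)).

Lemma continuous_gt0_near (f : R -> R) (t0 : R) : continuous f ->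
  a < t0 < b -> 0 < f t0 ->
  exists d, [/\ 0 < d, a <= t0 - d, t0 + d <= b &
    forall t, t0 - d <= t <= t0 + d -> f t0 / 2 <= f t].
Proof.
move=> cf /andP[at0 t0b] f0.
have : \forall t \near t0, f t0 / 2 < f t.
  apply: (cvgr_gt (f t0) (@cf t0)); lra.
rewrite -nbhs_nearE => /nbhs_ballP[e /= e0 fe].
exists (Num.min (e / 2) (Num.min (t0 - a) (b - t0))).
set d := Num.min _ _.
have de : d <= e / 2 by rewrite ge_min lexx.
have da : d <= t0 - a by rewrite !ge_min lexx orbT.
have db : d <= b - t0 by rewrite !ge_min lexx !orbT.
have d0 : 0 < d by rewrite !lt_min; apply/and3P; split; lra.
split; [exact: d0|lra|lra|move=> t tt].
apply/ltW/fe; rewrite /ball /= ltr_norml; lra.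
Qed.

Lemma continuous_integral_gt0 (f : R -> R) (t0 : R) : continuous f ->
  (forall t, 0 <= f t) -> a < t0 < b -> 0 < f t0 -> 0 < I f.
Proof.
move=> cf f0 tab ft0.
have [d [d0 ad db fd]] := continuous_gt0_near cf tab ft0.
have xy : t0 - d <= t0 + d by lra.
have fge0 t : a <= t <= b -> - 0 <= f t by rewrite oppr0.
have fge t : t0 - d <= t <= t0 + d -> f t0 / 2 - 0 <= f t.
  by rewrite subr0; exact: fd.
apply: lt_le_trans (segment_integral_ge cf ad xy db fge0 fge).
by rewrite mul0r subr0 mulr_gt0//; lra.
Qed.

(** Where [F = h * t ^+ K] is positive, near [t0], it is tested against the
    powers of a quadratic polynomial [q] that exceeds [1] near [t0] only and
    stays between [0] and [1] on the rest of [a, b]: the contribution of the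
    neighbourhood of [t0] grows without bound, the other one is bounded below. *)
Lemma moments_not_all0 (h : R -> R) (K : nat) (t0 : R) : continuous h ->
  0 <= a -> a < t0 < b -> 0 < h t0 ->
  ~ (forall k, (K <= k)%N -> I (fun t => h t * t ^+ k) = 0).
Proof.
move=> ch a0 tab ht0 m0; have /andP[at0 t0b] := tab.
pose F t := h t * t ^+ K.
have cF : continuous F.
  by move=> t; apply: cvgM; [exact: ch|exact: exprn_continuous].
have Ft0 : 0 < F t0 by rewrite mulr_gt0// exprn_gt0//; lra.
have [d [d0 ad db Fd]] := continuous_gt0_near cF tab Ft0.
have [M FM] : exists M, forall t, a <= t <= b -> `|F t| <= M.
  have cN : continuous (fun t => `|F t|).
    by move=> t; apply: cvg_norm; exact: cF.
  have [c _ Fc] := EVT_max (ltW (lt_trans at0 t0b)) (continuous_subspaceT cN).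
  by exists `|F c| => t tt; apply: Fc; rewrite in_itv.
pose L := b - a; have L0 : 0 < L by rewrite /L; lra.
pose e := (d / L) ^+ 2.
have e0 : 0 < e by rewrite exprn_gt0// divr_gt0.
(* [q.[t] = 1] exactly at distance [d] from [t0]. *)
pose q : {poly R} := (1 + e)%:P - L^-1 ^+ 2 *: ('X - t0%:P) ^+ 2.
have qE t : q.[t] = 1 + e - ((t - t0) / L) ^+ 2.
  rewrite /q !(hornerD, hornerN, hornerC, hornerZ, horner_exp, hornerXsubC).
  by rewrite hornerX; ring.
have sq_le (x y : R) : 0 <= y -> - y <= x <= y -> (x / L) ^+ 2 <= (y / L) ^+ 2.
  move=> y0 xy; rewrite -real_normK ?num_real//.
  rewrite lerXn2r ?nnegrE ?divr_ge0 ?(ltW L0)//.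
  rewrite normrM (ger0_norm (_ : 0 <= L^-1)) ?invr_ge0 ?(ltW L0)//.
  by rewrite ler_pM2r ?invr_gt0// ler_norml.
have q_ge0 t : a <= t <= b -> 0 <= q.[t].
  move=> tt; have := @sq_le (t - t0) L (ltW L0).
  rewrite divff ?gt_eqF// expr1n qE => /(_ _)/le_trans H.
  have : ((t - t0) / L) ^+ 2 <= 1 by apply: H => //; rewrite /L; lra.
  lra.
have q_le1 t : ~~ (t0 - d <= t <= t0 + d) -> q.[t] <= 1.
  move=> tf; rewrite qE.
  have : (d / L) ^+ 2 <= ((t - t0) / L) ^+ 2.
    rewrite -[leRHS]real_normK ?num_real//.
    rewrite lerXn2r ?nnegrE ?divr_ge0 ?(ltW L0) ?(ltW d0)//.
    rewrite normrM (ger0_norm (_ : 0 <= L^-1)) ?invr_ge0 ?(ltW L0)//.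
    rewrite ler_pM2r ?invr_gt0// leNgt.
    by apply: contra tf; rewrite ltr_norml; lra.
  rewrite -/e; lra.
have q_peak t : t0 - d / 2 <= t <= t0 + d / 2 -> 1 + 3 / 4 * e <= q.[t].
  move=> tt; rewrite qE.
  have : ((t - t0) / L) ^+ 2 <= (d / 2 / L) ^+ 2 by apply: sq_le; lra.
  rewrite (_ : (d / 2 / L) ^+ 2 = e / 4); last first.
    by rewrite /e; field; rewrite gt_eqF.
  lra.
have IQ N : I (fun t => F t * (q ^+ N).[t]) = 0.
  transitivity (I (fun t => h t * ('X ^+ K * q ^+ N).[t])).
    by apply: eq_Rintegral => t _; rewrite hornerM hornerXn mulrA.
  rewrite (integral_mul_horner _ _ ch (leqnn _)) big1// => i _.
  rewrite coefXnM; case: ltnP => Ki; first by rewrite mul0r.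
  by rewrite m0 ?mulr0.
pose c := F t0 / 2; have c0 : 0 < c by rewrite /c; lra.
have M0 : 0 <= M by apply: le_trans (FM a _) => //; rewrite lexx; lra.
have key N : c * (N%:R * (3 / 4 * e)) * d <= M * (b - a).
  have cFq : continuous (fun t => F t * (q ^+ N).[t]).
    by move=> t; apply: cvgM; [exact: cF|exact: continuous_horner].
  have xa : a <= t0 - d / 2 by lra.
  have xy : t0 - d / 2 <= t0 + d / 2 by lra.
  have yb : t0 + d / 2 <= b by lra.
  have low t : a <= t <= b -> - M <= F t * (q ^+ N).[t].
    move=> tt; have Ft := FM t tt.
    have [tn|tf] := boolP (t0 - d <= t <= t0 + d).
      have F0 : 0 <= F t by apply: le_trans (Fd _ tn); lra.
      have q0 : 0 <= q.[t] by apply: q_ge0.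
      rewrite (@le_trans _ _ 0)// ?oppr_le0// horner_exp.
      by rewrite mulr_ge0// exprn_ge0.
    have q0 : 0 <= q.[t] by apply: q_ge0.
    have q1 : q.[t] <= 1 by exact: q_le1.
    have : `|F t * (q ^+ N).[t]| <= M.
      rewrite normrM horner_exp (ger0_norm (exprn_ge0 N q0)).
      rewrite -[leRHS]mulr1; apply: ler_pM => //; first exact: exprn_ge0.
      exact: exprn_ile1.
    by rewrite ler_norml => /andP[].
  have peak t : t0 - d / 2 <= t <= t0 + d / 2 ->
      c * (N%:R * (3 / 4 * e)) - M <= F t * (q ^+ N).[t].
    move=> tt.
    have tn : t0 - d <= t <= t0 + d.
      by move/andP: tt => [? ?]; apply/andP; split; lra.
    have cF' := Fd _ tn; have qp := q_peak _ tt.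
    have : N%:R * (3 / 4 * e) <= (q ^+ N).[t].
      have e1 : 0 <= 3 / 4 * e by lra.
      rewrite horner_exp; apply: (le_trans _ (lerXn2r N _ _ qp)); last 2 first.
      - by rewrite nnegrE; lra.
      - by rewrite nnegrE (le_trans _ qp)//; lra.
      by apply: le_trans (bernoulli_ineq N e1); lra.
    set u := N%:R * _; set v := (q ^+ N).[t] => uv.
    have u0 : 0 <= u by rewrite /u mulr_ge0//; lra.
    have : c * u <= F t * v by rewrite ler_pM// ltW.
    lra.
  have := segment_integral_ge cFq xa xy yb low peak.
  rewrite IQ subr_le0; congr (_ * _ <= _); lra.
have A0 : 0 < c * (3 / 4 * e) * d.
  by apply: mulr_gt0 => //; apply: mulr_gt0 => //; lra.
have [N NM] : exists N : nat, M * L / (c * (3 / 4 * e) * d) < N%:R.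
  by exists (Num.truncn (M * L / (c * (3 / 4 * e) * d))).+1; exact: truncnS_gt.
move: NM; rewrite ltr_pdivrMr//.
rewrite (_ : N%:R * _ = c * (N%:R * (3 / 4 * e)) * d); last by ring.
by move=> /lt_le_trans /(_ (key N)); rewrite ltxx.
Qed.
End Peak.

(** * The moments of the ripple change sign infinitely often *)

Section WaveMoments.
Context {R : realType} (a b : R).
Hypotheses (a0 : 0 < a) (ab : a < b).
Local Notation w := (pi *+ 2 : R).
Local Notation I f := (\int[@lebesgue_measure R]_(t in `[a, b]) (f t)).

(** The log-normal perturbation, pulled back to ]a, b[ and extended by zero. *)
Definition ripple : R -> R := bump a b (fun x => wave (fun=> 1) x * jac x).

Lemma exptrig_ripple : exptrig w (fun x => wave (fun=> 1) x * jac x).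
Proof.
by apply: exptrig_mul; [apply: exptrig_wave; constructor|exact: exptrig_jac].
Qed.

(** With [y = (t - a) / (b - t)], one has [t / (1 - t / b) = b / (b - a) * (a
    + b * y)]. *)
Lemma ripple_generating K t :
  ripple t * (t / (1 - b^-1 * t)) ^+ K =
  bump a b (fun x => wave (fun y => expR y ^+ 0 *
    (a * b / (b - a) + b ^+ 2 / (b - a) * expR y) ^+ K) x * jac x) t.
Proof.
rewrite /ripple; have [tab|tout] := boolP (a < t < b); last first.
  by rewrite !bump_out// mul0r.
rewrite !bumpE// /wave expR_logit//.
have -> : t / (1 - b^-1 * t) =
    a * b / (b - a) + b ^+ 2 / (b - a) * ((t - a) / (b - t)).
  have /andP[ta tb] := tab.
  by field; rewrite !subr_eq0 !gt_eqF ?(lt_trans a0 ab).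
by rewrite expr0; ring.
Qed.

Lemma logit_surj x : exists2 t, a < t < b & logit a b t = x.
Proof.
have e0 := expR_gt0 x.
have e1 : 0 < 1 + expR x by lra.
have abe : 0 < (b - a) * expR x by rewrite mulr_gt0// subr_gt0.
exists ((a + b * expR x) / (1 + expR x)).
  have ab1 := ab; rewrite ltr_pdivlMr ?ltr_pdivrMr//.
  by apply/andP; split; lra.
rewrite /logit -[RHS]expRK; congr ln; field.
apply/andP; split; first by rewrite gt_eqF.
rewrite (_ : _ - _ = b - a); last by ring.
by rewrite subr_eq0 gt_eqF.
Qed.

(** Otherwise all moments of [s * ripple] beyond order [K] would vanish,
    although [s * ripple] is positive where the logit is [s / 4]. *)
Lemma ripple_moment_lt0 (s : R) (K : nat) : s = 1 \/ s = -1 ->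
  exists2 k, (K < k)%N & I (fun t => s * ripple t * t ^+ k) < 0.
Proof.
move=> s1; apply: contrapT => /forall2NP nk.
have cr : continuous ripple by exact: continuous_bump exptrig_ripple.
have csr : continuous (fun t => s * ripple t).
  by move=> t; apply: cvgM; [exact: cvg_cst|exact: cr].
pose W t := s * ripple t * (t / (1 - b^-1 * t)) ^+ K.+1.
pose V := bump a b (fun x => wave (fun y => expR y ^+ 0 *
    (a * b / (b - a) + b ^+ 2 / (b - a) * expR y) ^+ K.+1) x * jac x).
have WV : W = (fun t => s * V t).
  by apply/funext => t; rewrite /W -mulrA ripple_generating.
have cV : continuous V.
  apply: (@continuous_bump _ _ _ w).
  apply: exptrig_mul; last exact: exptrig_jac.
  by apply: exptrig_wave; exact: exptrig_expX_affine.
have cW : continuous W.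
  by rewrite WV => t; apply: cvgM; [exact: cvg_cst|exact: cV].
have W0 : I W = 0.
  rewrite WV RintegralZl//; last exact: continuous_segment_integrable.
  by rewrite integral_wave_affine// mulr0.
have b_out : s * ripple b = 0 by rewrite /ripple bump_out ?mulr0// ltxx andbF.
have m0 := moments_eq0 (ltW a0) ab csr b_out cW W0 _.
have [t0 tab lt0] : exists2 t0, a < t0 < b & logit a b t0 = s * 4^-1.
  exact: logit_surj.
apply: (@moments_not_all0 _ a b _ K.+1 t0 csr (ltW a0) tab).
  rewrite /ripple bumpE// lt0 /wave mulr1.
  have -> : s * (expR (- (s / 4) ^+ 2) * (sin (w * (s / 4)) * jac (s / 4))) =
     expR (- (s / 4) ^+ 2) * (s * sin (w * (s / 4)) * jac (s / 4)) by ring.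
  rewrite mulr_gt0 ?expR_gt0// mulr_gt0//; last first.
    by rewrite /jac !addr_gt0 ?expR_gt0.
  have -> : w * (s / 4) = s * (pi / 2) by rewrite -mulr_natr; field.
  case: s1 => ->; first by rewrite !mul1r sin_pihalf.
  by rewrite !mulN1r sinN sin_pihalf opprK.
apply: m0 => k Kk; rewrite leNgt; apply/negP => mk.
by have [] := nk k.
Qed.
End WaveMoments.

Lemma alternating_sequence (P Q : nat -> Prop) :
  (forall N, exists2 k, (N < k)%N & P k) ->
  (forall N, exists2 k, (N < k)%N & Q k) ->
  exists l : nat -> nat, [/\ forall n, (0 < l n)%N,
    forall m n, (m < n)%N -> (l m < l n)%N,
    forall n, odd n -> Q (l n) & forall n, ~~ odd n -> P (l n)].
Proof.
move=> exP exQ.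
have [p pP] : {p & forall N, (N < p N)%N /\ P (p N)}.
  apply: (@choice _ _ (fun N k => (N < k)%N /\ P k)) => N.
  by have [k] := exP N; exists k.
have [q qQ] : {q & forall N, (N < q N)%N /\ Q (q N)}.
  apply: (@choice _ _ (fun N k => (N < k)%N /\ Q k)) => N.
  by have [k] := exQ N; exists k.
pose l := fix l n :=
  if n is m.+1 then (if odd n then q else p) (l m) else p 0%N.
have lS n : (l n < l n.+1)%N.
  by rewrite /=; case: ifP => _; [have [] := qQ (l n)|have [] := pP (l n)].
exists l; split.
- elim=> [|n IH]; first by have [] := pP 0%N.
  exact: ltn_trans IH (lS n).
- exact: (homo_ltn ltn_trans lS).
- by case=> [//|n] /= nodd; rewrite nodd; have [] := qQ (l n).
- case=> [_|n] /=; first by have [] := pP 0%N.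
  by move=> /negbTE ->; have [] := pP (l n).
Qed.
(** * Moments of a continuous density supported on a segment *)

Section SupportedDensity.
Context {R : realType} (a b : R) (f : R -> R).
Hypotheses (a0 : 0 < a) (cf : continuous f).
Hypothesis f_out : forall t, ~~ (a <= t <= b) -> f t = 0.
Local Notation I f := (\int[@lebesgue_measure R]_(t in `[a, b]) (f t)).

Lemma integral_supported :
  (\int[@lebesgue_measure R]_t (f t)%:E)%E = (I f)%:E.
Proof.
rewrite /Rintegral fineK; last first.
  by apply: integrable_fin_num => //; exact: continuous_segment_integrable.
rewrite [RHS]integral_mkcond; apply: eq_integral => t _.
rewrite patchE; case: ifPn => // tab; rewrite f_out//.
by apply: contra tab => tab; rewrite inE /= in_itv.
Qed.

Variable mu : probability (measurableTypeR R) R.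
Hypothesis muf : is_density mu f.

Lemma density_supported : supported_on mu `[a, b].
Proof.
have [_ _ muE] := muf.
rewrite /supported_on muE; last exact: measurableC.
apply: integral0_eq => t /= tab; rewrite f_out//.
by apply/negP => tt; apply: tab; rewrite in_itv.
Qed.

Lemma moment_density k : moment mu k = (I (fun t => f t * t ^+ k))%:E.
Proof.
have mD : measurable (`[a, b] : set (measurableTypeR R)) by [].
have mX (A : set (measurableTypeR R)) :
    measurable_fun A (fun t : measurableTypeR R => t ^+ k : R).
  apply: measurable_funTS; apply: continuous_measurable_fun.
  exact: exprn_continuous.
have iX : mu.-integrable `[a, b] (EFin \o (fun t => t ^+ k)).
  apply: measurable_bounded_integrable => //.
    exact: le_lt_trans (probability_le1 _ _) (ltry 1).
  exists (b ^+ k); split; first exact: num_real.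
  move=> M bM t; rewrite /= in_itv /= => /andP[at_ tb].
  rewrite ger0_norm ?exprn_ge0//; last by rewrite (le_trans _ at_)// ltW.
  apply: le_trans (ltW bM); rewrite lerXn2r ?nnegrE//; have := a0; lra.
transitivity (\int[mu]_(x in `[0%R, +oo[ `\` ~` `[a, b]) (x ^+ k)%:E)%E.
  apply: ge0_negligible_integral => //.
  - exact: measurableC.
  - by apply/measurable_EFinP; exact: mX.
  - by move=> t; rewrite /= in_itv /= andbT => t0; rewrite lee_fin exprn_ge0.
  - exact: density_supported.
rewrite setDE setCK setIidr; last first.
  by apply: subset_itv; rewrite bnd_simp// ltW.
rewrite (density_integral muf mD iX) /Rintegral fineK.
  by apply: eq_integral => t _; rewrite mulrC.
apply: integrable_fin_num => //; apply: continuous_segment_integrable => t.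
by apply: cvgM; [exact: cf|exact: exprn_continuous].
Qed.
End SupportedDensity.

(** * Two measures with alternating moments *)

Theorem theorem18 (R : realType) (a b : R) (ha : 0 < a) (hab : a < b) :
  exists (mu_f mu_g : probability (measurableTypeR R) R) (f g : R -> R)
    (l : nat -> nat),
    [/\ mu_f `<< (@lebesgue_measure R) /\ mu_g `<< (@lebesgue_measure R),
        supported_on mu_f `[a, b] /\ supported_on mu_g `[a, b],
        [/\ is_density mu_f f, smooth f & fun_supp f `<=` `[a, b]],
        [/\ is_density mu_g g, smooth g & fun_supp g `<=` `[a, b]]
      & [/\ forall n : nat, (0 < l n)%N,
            forall m n : nat, (m < n)%N -> (l m < l n)%N,
            forall n : nat, odd n -> (moment mu_f (l n) < moment mu_g (l n))%E
          & forall n : nat, ~~ odd n ->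
              (moment mu_g (l n) < moment mu_f (l n))%E]].
Proof.
pose I (u : R -> R) : R := \int[@lebesgue_measure R]_(t in `[a, b]) u t.
have Mj : exptrig (pi *+ 2 : R) jac by exact: exptrig_jac.
pose Z := I (bump a b jac).
have j0 (x : R) : 0 < jac x by rewrite /jac !addr_gt0 ?expR_gt0.
have Z0 : 0 < Z.
  apply: (@continuous_integral_gt0 _ _ _ _ ((a + b) / 2)).
  - exact: continuous_bump Mj.
  - move=> t; rewrite /bump; case: ifP => // _.
    by rewrite mulr_ge0 ?expR_ge0// ltW ?j0.
  - by apply/andP; split; lra.
  - rewrite bumpE; first by rewrite mulr_gt0 ?expR_gt0 ?j0.
    by apply/andP; split; lra.
pose qg (x : R) := Z^-1 * jac x.
pose qf (x : R) := Z^-1 * ((1 + sin (pi *+ 2 * x)) * jac x).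
have Mg : exptrig (pi *+ 2) qg by apply: exptrig_mul => //; constructor.
have Mf : exptrig (pi *+ 2) qf.
  apply: exptrig_mul; first by constructor.
  by apply: exptrig_mul => //; do !constructor.
have cg : continuous (bump a b qg) by exact: continuous_bump Mg.
have cf : continuous (bump a b qf) by exact: continuous_bump Mf.
have cr : continuous (ripple a b) by exact: continuous_bump exptrig_ripple.
have fE t : bump a b qf t = bump a b qg t + Z^-1 * ripple a b t.
  rewrite /ripple -bumpZ -bumpD; apply: eq_bump => x.
  by rewrite /qf /qg /wave; ring.
have iX (u : R -> R) k : continuous u ->
    (@lebesgue_measure R).-integrable `[a, b] (EFin \o (fun t => u t * t ^+ k)).
  move=> cu; apply: continuous_segment_integrable => t.
  by apply: cvgM; [exact: cu|exact: exprn_continuous].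
have momE k : I (fun t => bump a b qf t * t ^+ k) =
    I (fun t => bump a b qg t * t ^+ k) +
    Z^-1 * I (fun t => ripple a b t * t ^+ k).
  rewrite /I -RintegralZl//; last exact: iX.
  rewrite -RintegralD//; last 2 first.
  - exact: iX.
  - exact: (integrableZl _ _ (iX _ _ cr)).
  by apply: eq_Rintegral => t _; rewrite fE; ring.
have g_ge0 t : 0 <= bump a b qg t.
  rewrite /bump; case: ifP => // _; rewrite mulr_ge0 ?expR_ge0//.
  by rewrite mulr_ge0 ?invr_ge0 ?(ltW Z0) ?(ltW (j0 _)).
have f_ge0 t : 0 <= bump a b qf t.
  rewrite /bump; case: ifP => // _; rewrite mulr_ge0 ?expR_ge0//.
  by rewrite mulr_ge0 ?invr_ge0 ?(ltW Z0)// mulr_ge0 ?(ltW (j0 _)).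
have out q t : ~~ (a <= t <= b) -> bump a b q t = 0.
  move=> tab; rewrite bump_out//.
  by apply: contra tab => /andP[? ?]; rewrite !ltW.
have intg : I (bump a b qg) = 1.
  transitivity (I (fun t => Z^-1 * bump a b jac t)).
    by apply: eq_Rintegral => t _; rewrite -bumpZ.
  rewrite /I RintegralZl ?mulVf ?gt_eqF//.
  by apply: continuous_segment_integrable; exact: continuous_bump Mj.
have intf : I (bump a b qf) = 1.
  have := momE 0%N.
  have E (u : R -> R) : I (fun t => u t * t ^+ 0) = I u.
    by apply: eq_Rintegral => t _; rewrite expr0 mulr1.
  rewrite !E intg => ->; rewrite [I _](_ : _ = 0) ?mulr0 ?addr0//.
  (* The total mass of the ripple is its moment of order [0] in [expR u]. *)
  rewrite -[RHS](integral_wave_affine hab 0 0 0 0); apply: eq_Rintegral => t _.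
  by apply: eq_bump => x; rewrite /wave !expr0 !mulr1.
have prob (u : R -> R) : continuous u -> (forall t, 0 <= u t) ->
    (forall t, ~~ (a <= t <= b) -> u t = 0) -> I u = 1 ->
    exists mu : probability (measurableTypeR R) R, is_density mu u.
  move=> cu u0 uout u1; apply: exists_density_probability => //.
    exact: continuous_measurable_fun.
  by rewrite (integral_supported cu uout) -/(I u) u1.
have [mu_f df] := prob _ cf f_ge0 (out qf) intf.
have [mu_g dg] := prob _ cg g_ge0 (out qg) intg.
have scaleI (s : R) k : I (fun t => s * ripple a b t * t ^+ k) =
    s * I (fun t => ripple a b t * t ^+ k).
  rewrite /I -RintegralZl//; last exact: iX.
  by apply: eq_Rintegral => t _; rewrite mulrA.
have momf k : moment mu_f k = (I (fun t => bump a b qf t * t ^+ k))%:E.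
  exact: moment_density ha cf (out qf) mu_f df k.
have momg k : moment mu_g k = (I (fun t => bump a b qg t * t ^+ k))%:E.
  exact: moment_density ha cg (out qg) mu_g dg k.
have pos N : exists2 k, (N < k)%N & 0 < I (fun t => ripple a b t * t ^+ k).
  have [k Nk] := ripple_moment_lt0 ha hab N (or_intror erefl).
  by rewrite -/(I _) scaleI mulN1r oppr_lt0; exists k.
have neg N : exists2 k, (N < k)%N & I (fun t => ripple a b t * t ^+ k) < 0.
  have [k Nk] := ripple_moment_lt0 ha hab N (or_introl erefl).
  by rewrite -/(I _) scaleI mul1r; exists k.
have [l [l0 l_incr l_odd l_even]] := alternating_sequence pos neg.
exists mu_f, mu_g, (bump a b qf), (bump a b qg), l; split.
- by split; [exact: density_dominates df|exact: density_dominates dg].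
- split; first exact: density_supported (out qf) _ df.
  exact: density_supported (out qg) _ dg.
- by split; [exact: df|exact: smooth_bump Mf|exact: fun_supp_bump].
- by split; [exact: dg|exact: smooth_bump Mg|exact: fun_supp_bump].
- split=> // n nodd.
  + by rewrite momf momg lte_fin momE gtrDl pmulr_rlt0 ?invr_gt0// l_odd.
  + by rewrite momf momg lte_fin momE ltrDl pmulr_rgt0 ?invr_gt0// l_even.
Qed.
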